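(* Let $m\in\mathbb{N}$ and $n\in\mathbb{N}_0$ with $1\le m\le n$, $\theta'\in[0,\pi]$, and $\phi,\phi'\in[0,2\pi)$. Then \[ \int_0^\pi P_n(\cos\gamma)\,\mathrm{P}^m_n(\cos\theta)\,\frac{1}{\sin\theta}\,d\theta=\frac{2}{m}\,\mathrm{P}^m_n(\cos\theta')\cos(m(\phi-\phi')), \] where $\cos\gamma=\cos\theta\cos\theta'+\sin\theta\sin\theta'\cos(\phi-\phi')$.
   Context: $P_n$ is the Legendre polynomial, $P_n(z)={}_2F_1\!\left(-n,n+1;1;\frac{1-z}{2}\right)$. $\mathrm{P}^m_n$ is the Ferrers function of the first kind: for integers $0\le m\le n$ and $x\in[-1,1]$, $\mathrm{P}^m_n(x)=(-1)^m(1-x^2)^{m/2}\frac{d^m}{dx^m}P_n(x)$. *)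

(* Defs.v *)
From Stdlib Require Import Reals.
From Coquelicot Require Import Coquelicot.
Open Scope R_scope.

Fixpoint poch (a : R) (k : nat) : R :=
  match k with
  | O => 1
  | S k' => poch a k' * (a + INR k')
  end.

(* Legendre polynomial P_n(z) = 2F1(-n, n+1; 1; (1-z)/2).
   The hypergeometric series terminates: terms with k > n vanish since (-n)_k = 0.
   Note (1)_k = k!, so the k-th term is (-n)_k (n+1)_k / (k! * k!) * y^k. *)
Definition legendreP (n : nat) (z : R) : R :=
  sum_f_R0 (fun k => poch (- INR n) k * poch (INR n + 1) k
                      / (INR (Factorial.fact k) * INR (Factorial.fact k)) * ((1 - z) / 2) ^ k) n.

(* Ferrers function of the first kind, for integers 0 <= m <= n, x in [-1,1]:
   P^m_n(x) = (-1)^m (1-x^2)^{m/2} d^m/dx^m P_n(x).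
   (1-x^2)^{m/2} is written as sqrt(1-x^2)^m (equal for x in [-1,1]). *)
Definition ferrersP (m n : nat) (x : R) : R :=
  (-1) ^ m * (sqrt (1 - x ^ 2)) ^ m * Derive_n (legendreP n) m x.

(* Main.v *)
(** Write [x = cos theta], [y = cos theta'], [s = cos (phi - phi')], let [D_k] be the
    [k]-th derivative of [P_n], and Taylor-expand [P_n(cos gamma)] about [x y]:
    the integral becomes [(-1)^m sum_k (sin theta')^k s^k J_k(y) / k!] with
    [J_k(y) = int_0^pi sin^(m+k-1) D_k(x y) D_m(x) dtheta].
    Green's identity for the associated Legendre equation gives
    [(1 - y^2) J_(k+2) = (k^2 - m^2) J_k], so that the coefficients of the powers of [s]
    obey the recurrence of the Chebyshev polynomial [T_m]; since they vanish for [k > n],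
    the sum is a multiple of [T_m(s) = cos (m (phi - phi'))] fixed by its [s^m]
    coefficient.  That coefficient comes from [J_m(y) = 2^m (m-1)! D_m(y)]: by parity
    one may insert a factor [1 + x] into the integrand of [J_m], after which
    orthogonality of [D_m] for the weight [(1 - x^2)^m] makes the integral against
    every monomial [x^j] with [j <= n - m] independent of [j]. *)

Require Import Defs.
From Stdlib Require Import Reals Factorial Lra Lia.
From Coquelicot Require Import Coquelicot.
Open Scope R_scope.

Set Bullet Behavior "Strict Subproofs".
#[local] Arguments INR : simpl never.
#[local] Arguments fact : simpl never.

(** * Derivatives of the Legendre polynomial in closed form *)

(* [i!] times the coefficient of [((1 - z) / 2)^i] in [P_n(z)]. *)
Definition legendre_taylor_coef (n i : nat) : R :=
  poch (- INR n) i * poch (INR n + 1) i / INR (fact i).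

(** The [k]-th derivative of the hypergeometric series in [y = (1 - z) / 2], cut off at [y^N]. The
    cutoff is kept apart from the degree so that identities can be proved by induction on it. *)
Definition legendre_series (n N k : nat) (y : R) : R :=
  sum_f_R0 (fun i => legendre_taylor_coef n (k + i) / INR (fact i) * y ^ i) N.

(** A closed form of [D_k]: the power of [-1/2] comes from the chain rule, and since coefficients
    beyond the degree vanish, the cutoff [n] serves for every [k]. *)
Definition legendreD (n k : nat) (z : R) : R :=
  (- / 2) ^ k * legendre_series n n k ((1 - z) / 2).

Lemma INR_fact_0 : INR (fact 0) = 1.
Proof. reflexivity. Qed.

Lemma INR_fact_S (i : nat) : INR (fact (S i)) = (INR i + 1) * INR (fact i).
Proof. rewrite fact_simpl, mult_INR, S_INR; ring. Qed.

Lemma legendre_taylor_coef_S (n i : nat) :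
  (INR i + 1) * legendre_taylor_coef n (S i) =
  (INR i - INR n) * (INR i + INR n + 1) * legendre_taylor_coef n i.
Proof.
  unfold legendre_taylor_coef; rewrite INR_fact_S; cbn [poch].
  pose proof (INR_fact_neq_0 i); pose proof (pos_INR i).
  field; split; lra.
Qed.

(** The factor [i - n] of the recurrence vanishes at [i = n] and so kills every later
    coefficient. *)
Lemma legendre_taylor_coef_gt (n i : nat) : (n < i)%nat -> legendre_taylor_coef n i = 0.
Proof.
  intros H; induction i as [|i IH]; [lia|].
  pose proof (legendre_taylor_coef_S n i) as E; pose proof (pos_INR i).
  assert (Z : (INR i - INR n) * (INR i + INR n + 1) * legendre_taylor_coef n i = 0).
  { destruct (Nat.eq_dec n i) as [->|]; [ring|].
    rewrite IH by lia; ring. }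
  rewrite Z in E; apply Rmult_integral in E; destruct E; lra.
Qed.

(** The subtracted term is the top one of the next series, which differentiating a sum cut off at
    [y^N] does not produce. *)
Lemma is_derive_legendre_series (n N k : nat) (y : R) :
  is_derive (legendre_series n N k) y
    (legendre_series n N (S k) y - legendre_taylor_coef n (S k + N) / INR (fact N) * y ^ N).
Proof.
  induction N as [|N IH].
  - unfold legendre_series; cbn [sum_f_R0].
    apply (is_derive_ext (fun _ => legendre_taylor_coef n (k + 0) / INR (fact 0))).
    { intros t; simpl; ring. }
    replace (_ - _) with 0 by (simpl; ring).
    apply (is_derive_const (K := R_AbsRing) (V := R_NormedModule)).
  - apply (is_derive_ext (fun y => legendre_series n N k y
        + legendre_taylor_coef n (k + S N) / INR (fact (S N)) * y ^ S N)); [reflexivity|].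
    replace (legendre_series n (S N) (S k) y - _) with
      ((legendre_series n N (S k) y - legendre_taylor_coef n (S k + N) / INR (fact N) * y ^ N)
       + legendre_taylor_coef n (k + S N) / INR (fact (S N)) * (INR (S N) * y ^ N)).
    + apply (is_derive_plus (K := R_AbsRing) (V := R_NormedModule)); [exact IH|].
      generalize (legendre_taylor_coef n (k + S N) / INR (fact (S N))); intros c.
      auto_derive; [trivial|]; simpl pred; ring.
    + unfold legendre_series; cbn [sum_f_R0].
      replace (S k + N)%nat with (k + S N)%nat by lia.
      rewrite INR_fact_S, S_INR.
      pose proof (INR_fact_neq_0 N); pose proof (pos_INR N).
      field; split; lra.
Qed.

Lemma is_derive_legendreD (n k : nat) (z : R) :
  is_derive (legendreD n k) z (legendreD n (S k) z).
Proof.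
  pose proof (is_derive_legendre_series n n k ((1 - z) / 2)) as H.
  rewrite (legendre_taylor_coef_gt n (S k + n)) in H by lia.
  unfold legendreD.
  evar_last.
  - apply (is_derive_scal (fun z => legendre_series n n k ((1 - z) / 2)) z).
    apply (is_derive_comp (legendre_series n n k) (fun z => (1 - z) / 2)); [exact H|].
    auto_derive; [trivial|reflexivity].
  - unfold scal; simpl; unfold mult; simpl; field; apply INR_fact_neq_0.
Qed.

Lemma ex_derive_legendreD (n k : nat) (z : R) : ex_derive (legendreD n k) z.
Proof. eexists; apply is_derive_legendreD. Qed.

Lemma Derive_legendreD (n k : nat) (z : R) :
  Derive (legendreD n k) z = legendreD n (S k) z.
Proof. apply is_derive_unique, is_derive_legendreD. Qed.

Lemma legendreD_0 (n : nat) (z : R) : legendreD n 0 z = legendreP n z.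
Proof.
  unfold legendreD, legendre_series, legendreP, legendre_taylor_coef; rewrite pow_O, Rmult_1_l.
  apply sum_eq; intros i _; cbn [Nat.add].
  pose proof (INR_fact_neq_0 i); field; assumption.
Qed.

Lemma Derive_n_legendreP (n k : nat) (z : R) :
  Derive_n (legendreP n) k z = legendreD n k z.
Proof.
  revert z; induction k as [|k IH]; intros z.
  - symmetry; apply legendreD_0.
  - simpl; rewrite (Derive_ext _ _ _ IH); apply Derive_legendreD.
Qed.

Lemma legendreD_gt (n k : nat) (z : R) : (n < k)%nat -> legendreD n k z = 0.
Proof.
  intros H; unfold legendreD, legendre_series.
  rewrite (sum_eq _ (fun _ => 0)).
  - rewrite sum_cte; ring.
  - intros i _; rewrite legendre_taylor_coef_gt by lia; unfold Rdiv; ring.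
Qed.

Lemma legendreD_0_1 (n : nat) : legendreD n 0 1 = 1.
Proof.
  unfold legendreD, legendre_series; replace ((1 - 1) / 2) with 0 by field.
  destruct n as [|n].
  - unfold legendre_taylor_coef; simpl; rewrite INR_fact_0; field.
  - rewrite decomp_sum by lia.
    rewrite (sum_eq _ (fun _ => 0)).
    + rewrite sum_cte; unfold legendre_taylor_coef; simpl; rewrite INR_fact_0; field.
    + intros i _; rewrite pow_i by lia; ring.
Qed.

(** * The differential equation of the derivatives *)

(** The hypergeometric equation differentiated [k] times, for the truncated series. The coefficient
    recurrence cancels all but the top terms on the right, and these vanish once [N = n]. *)
Lemma legendre_series_ode (n N k : nat) (y : R) :
  y * (1 - y) * legendre_series n N (S (S k)) y
  + (INR k + 1) * (1 - 2 * y) * legendre_series n N (S k) y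
  + (INR n - INR k) * (INR n + INR k + 1) * legendre_series n N k y
  = y ^ S N / INR (fact N)
    * ((1 - y) * legendre_taylor_coef n (S (S k) + N)
       - (INR N + 2 * (INR k + 1)) * legendre_taylor_coef n (S k + N)).
Proof.
  induction N as [|N IH].
  - unfold legendre_series; cbn [sum_f_R0]; rewrite !Nat.add_0_r.
    pose proof (legendre_taylor_coef_S n k) as E; rewrite INR_fact_0, INR_0, pow_O, pow_1.
    nra.
  - assert (R : forall j, legendre_series n (S N) j y =
      legendre_series n N j y + legendre_taylor_coef n (j + S N) / INR (fact (S N)) * y ^ S N)
      by reflexivity.
    rewrite !R; clear R.
    pose proof (legendre_taylor_coef_S n (S k + N)) as E.
    replace (S (S k) + S N)%nat with (S (S (S k) + N)) by lia.
    replace (S k + S N)%nat with (S (S k + N)) by lia.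
    replace (k + S N)%nat with (S k + N)%nat by lia.
    replace (S (S k) + N)%nat with (S (S k + N)) in * by lia.
    set (t0 := legendre_taylor_coef n (S k + N)) in *.
    set (t1 := legendre_taylor_coef n (S (S k + N))) in *.
    set (t2 := legendre_taylor_coef n (S (S (S k + N)))).
    rewrite INR_fact_S, !S_INR in *; rewrite !plus_INR, !S_INR in E.
    pose proof (INR_fact_neq_0 N); pose proof (pos_INR N).
    match goal with |- ?A = _ =>
      replace A with
       ((y * (1 - y) * legendre_series n N (S (S k)) y
        + (INR k + 1) * (1 - 2 * y) * legendre_series n N (S k) y
        + (INR n - INR k) * (INR n + INR k + 1) * legendre_series n N k y)
       + y ^ S N / ((INR N + 1) * INR (fact N)) *
         (y * (1 - y) * t2 + (INR k + 1) * (1 - 2 * y) * t1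
          + (INR n - INR k) * (INR n + INR k + 1) * t0)) by (field; split; lra)
    end.
    rewrite IH.
    replace (y ^ S (S N)) with (y * y ^ S N) by (simpl; ring).
    apply Rminus_diag_uniq.
    match goal with |- ?A = 0 =>
      replace A with (y ^ S N / ((INR N + 1) * INR (fact N)) *
        ((INR k + 1 + INR N + 1) * t1
         - (INR k + 1 + INR N - INR n) * (INR k + 1 + INR N + INR n + 1) * t0))
      by (field; split; lra)
    end.
    rewrite E; ring.
Qed.

Lemma legendreD_ode (n k : nat) (z : R) :
  (1 - z ^ 2) * legendreD n (S (S k)) z
  = 2 * (INR k + 1) * z * legendreD n (S k) z
    - (INR n - INR k) * (INR n + INR k + 1) * legendreD n k z.
Proof.
  pose proof (legendre_series_ode n n k ((1 - z) / 2)) as H.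
  rewrite (legendre_taylor_coef_gt n (S (S k) + n)), (legendre_taylor_coef_gt n (S k + n)) in H by lia.
  unfold legendreD; cbn [pow].
  apply Rminus_diag_uniq.
  match goal with |- ?A = 0 => replace A with ((- / 2) ^ k *
     ((1 - z) / 2 * (1 - (1 - z) / 2) * legendre_series n n (S (S k)) ((1 - z) / 2) +
     (INR k + 1) * (1 - 2 * ((1 - z) / 2)) * legendre_series n n (S k) ((1 - z) / 2) +
     (INR n - INR k) * (INR n + INR k + 1) * legendre_series n n k ((1 - z) / 2))) by field
  end.
  rewrite H; ring.
Qed.

(** * Taylor expansion and parity *)

(** Seen as a function of the expansion point, the Taylor sum has a telescoping derivative whose one
    remaining term contains [D_(m+N+1) = 0]. The sum is therefore constant, and at the point [b] it
    is [D_m(b)]. *)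
Lemma legendreD_taylor (n m N : nat) (a b : R) : (n <= m + N)%nat ->
  legendreD n m b =
  sum_f_R0 (fun k => legendreD n (m + k) a * ((b - a) ^ k / INR (fact k))) N.
Proof.
  intros HN.
  set (f := fun M t =>
    sum_f_R0 (fun k => legendreD n (m + k) t * ((b - t) ^ k / INR (fact k))) M).
  assert (Hf : forall M t,
    is_derive (f M) t (legendreD n (m + S M) t * ((b - t) ^ M / INR (fact M)))).
  { induction M as [|M IH]; intros t; unfold f; cbn [sum_f_R0].
    - apply (is_derive_ext (legendreD n m)).
      { intros s; rewrite Nat.add_0_r, INR_fact_0; simpl; field. }
      evar_last; [apply is_derive_legendreD|].
      replace (m + 1)%nat with (S m) by lia; rewrite INR_fact_0; simpl; field.
    - assert (Hp : is_derive (fun t => (b - t) ^ S M / INR (fact (S M))) t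
                     (- ((b - t) ^ M / INR (fact M)))).
      { clear IH; pose proof (INR_fact_neq_0 M); pose proof (pos_INR M).
        rewrite INR_fact_S; generalize dependent (INR (fact M)); intros c Hc.
        evar_last; [auto_derive; [trivial|reflexivity]|].
        rewrite S_INR; simpl pred.
        unfold Rminus; field; split; lra. }
      evar_last.
      + apply (is_derive_plus (K := R_AbsRing) (V := R_NormedModule)); [apply IH|].
        apply (is_derive_mult (legendreD n (m + S M)) _ _ _ _
                 (is_derive_legendreD n _ t) Hp).
        intros u v; apply Rmult_comm.
      + replace (m + S (S M))%nat with (S (m + S M)) by lia.
        unfold plus, mult; cbn -[pow fact INR legendreD]; ring. }
  assert (H0 : forall t, is_derive (f N) t zero).
  { intros t; evar_last; [apply Hf|].
    rewrite legendreD_gt by lia; apply Rmult_0_l. }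
  assert (E : f N a = f N b).
  { destruct (Rtotal_order a b) as [L|[->|L]].
    - apply (eq_is_derive (f N)); auto.
    - reflexivity.
    - symmetry; apply (eq_is_derive (f N)); auto. }
  unfold f in E; rewrite E.
  destruct N as [|N].
  - simpl; rewrite Nat.add_0_r, INR_fact_0; field.
  - rewrite decomp_sum by lia.
    rewrite (sum_eq _ (fun _ => 0)).
    + rewrite sum_cte, Nat.add_0_r, INR_fact_0; simpl; field.
    + intros i _; replace (b - b) with 0 by ring; rewrite pow_i by lia.
      unfold Rdiv; ring.
Qed.

(** At [z = 0] the differential equation ties [D_(k+2)] to [D_k] with a nonzero factor for [k < n];
    one descends in steps of two from [D_(n+1) = 0]. *)
Lemma legendreD_at_0_odd (n r k : nat) :
  (k + 2 * r + 1 = n)%nat -> legendreD n k 0 = 0.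
Proof.
  revert k; induction r as [|r IH]; intros k Hk.
  all: pose proof (legendreD_ode n k 0) as E.
  - rewrite (legendreD_gt n (S (S k))) in E by lia.
    assert (0 < INR n - INR k) by (apply Rlt_0_minus, lt_INR; lia).
    pose proof (pos_INR n); pose proof (pos_INR k).
    assert (0 < (INR n - INR k) * (INR n + INR k + 1)) by nra.
    nra.
  - rewrite (IH (S (S k))) in E by lia.
    assert (0 < INR n - INR k) by (apply Rlt_0_minus, lt_INR; lia).
    pose proof (pos_INR n); pose proof (pos_INR k).
    assert (0 < (INR n - INR k) * (INR n + INR k + 1)) by nra.
    nra.
Qed.

(** In the expansion at [0] only exponents of the parity of [n - m] survive. *)
Lemma legendreD_opp (n m : nat) (z : R) : (m <= n)%nat ->
  legendreD n m (- z) = (-1) ^ (n - m) * legendreD n m z.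
Proof.
  intros Hm.
  rewrite (legendreD_taylor n m (n - m) 0 z), (legendreD_taylor n m (n - m) 0 (- z))
    by lia.
  rewrite scal_sum; apply sum_eq; intros j Hj.
  rewrite !Rminus_0_r.
  replace (- z) with (-1 * z) by ring; rewrite Rpow_mult_distr.
  destruct (Nat.Even_or_Odd (n - m - j)) as [[r Hr]|[r Hr]].
  - replace (n - m)%nat with (j + 2 * r)%nat by lia.
    rewrite pow_add, pow_1_even; unfold Rdiv; ring.
  - rewrite (legendreD_at_0_odd n r) by lia; ring.
Qed.

(** * Integration tools *)

Ltac continuity_by_derive :=
  intros; apply (ex_derive_continuous (K := R_AbsRing) (V := R_NormedModule));
  auto_derive; repeat split; auto using ex_derive_legendreD.

Lemma ex_RInt_cont (f : R -> R) (a b : R) :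
  (forall t, continuous f t) -> ex_RInt f a b.
Proof.
  intros H; apply (ex_RInt_continuous (V := R_CompleteNormedModule)); auto.
Qed.

Lemma RInt_lin2 (a b : R) (f g : R -> R) (u v : R) :
  (forall t, continuous f t) -> (forall t, continuous g t) ->
  RInt (fun t => a * f t + b * g t) u v = a * RInt f u v + b * RInt g u v.
Proof.
  intros Hf Hg; apply is_RInt_unique.
  apply (is_RInt_plus (V := R_NormedModule));
    apply (is_RInt_scal (V := R_NormedModule));
    apply (RInt_correct (V := R_CompleteNormedModule)), ex_RInt_cont; assumption.
Qed.

(** The form in which integration by parts is used below: an explicit primitive [W] turns into a
    linear relation between two integrals. *)
Lemma RInt_lin2_exact (W : R -> R) (a b : R) (f g : R -> R) (u v : R) :
  (forall t, continuous f t) -> (forall t, continuous g t) ->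
  (forall t, is_derive W t (a * f t + b * g t)) ->
  a * RInt f u v + b * RInt g u v = W v - W u.
Proof.
  intros Hf Hg HW; rewrite <- RInt_lin2 by assumption.
  apply is_RInt_unique, (is_RInt_derive (V := R_CompleteNormedModule)); intros t _.
  - apply HW.
  - apply (continuous_plus (V := R_NormedModule));
      apply (continuous_scal_r (V := R_NormedModule)); auto.
Qed.

Lemma sin_mul_sin (t : R) : sin t * sin t = 1 - cos t ^ 2.
Proof. pose proof (sin2 t) as H; unfold Rsqr in H; rewrite H; ring. Qed.

(** * Orthogonality and moments *)

(** With [x = cos t], integration by parts from the self-adjoint form of the equation:
    [(1 - x^2)^(m+1) D_(m+1)] has derivative [-(n - m)(n + m + 1) (1 - x^2)^m D_m]. At [j = 0] the
    factor [INR j] makes the value of [pred j] harmless. *)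
Lemma RInt_legendreD_moment_S (n m j : nat) :
  (INR n - INR m) * (INR n + INR m + 1)
  * RInt (fun t => sin t ^ (2 * m + 1) * cos t ^ j * legendreD n m (cos t)) 0 PI
  = INR j * RInt (fun t => sin t ^ (2 * S m + 1) * cos t ^ pred j
                             * legendreD n (S m) (cos t)) 0 PI.
Proof.
  pose proof (RInt_lin2_exact
    (fun t => sin t ^ (2 * m + 2) * cos t ^ j * legendreD n (S m) (cos t))
    ((INR n - INR m) * (INR n + INR m + 1)) (- INR j)
    (fun t => sin t ^ (2 * m + 1) * cos t ^ j * legendreD n m (cos t))
    (fun t => sin t ^ (2 * S m + 1) * cos t ^ pred j * legendreD n (S m) (cos t))
    0 PI) as E; cbv beta in E.
  rewrite sin_0, sin_PI, !pow_i in E by lia.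
  apply Rminus_diag_uniq; etransitivity; [|etransitivity; [apply E|ring]]; [ring|..].
  - continuity_by_derive.
  - continuity_by_derive.
  - clear E; intros t.
    replace (2 * S m + 1)%nat with (S (S (2 * m + 1))) by lia.
    replace (2 * m + 2)%nat with (S (2 * m + 1)) by lia.
    assert (He : INR (2 * m + 1) = 2 * INR m + 1)
      by (rewrite plus_INR, mult_INR, INR_1; reflexivity).
    generalize dependent (2 * m + 1)%nat; intros e He.
    auto_derive; [auto using ex_derive_legendreD|].
    rewrite Derive_legendreD.
    pose proof (legendreD_ode n m (cos t)) as O.
    rewrite <- sin_mul_sin in O.
    simpl pred; rewrite S_INR, He; cbn [pow].
    generalize (sin t ^ e); intros S.
    apply Rminus_diag_uniq.
    match goal with |- ?A = 0 => replace A with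
      (S * cos t ^ j * (2 * (INR m + 1) * cos t * legendreD n (Datatypes.S m) (cos t) -
      (INR n - INR m) * (INR n + INR m + 1) * legendreD n m (cos t)
       - sin t * sin t * legendreD n (Datatypes.S (Datatypes.S m)) (cos t))) by ring end.
    rewrite O; ring.
Qed.

(** Each integration by parts raises [m] and lowers [j], keeping [m + j < n], until the factor
    [j = 0] appears. *)
Lemma RInt_legendreD_moment (n m j : nat) : (m + j < n)%nat ->
  RInt (fun t => sin t ^ (2 * m + 1) * cos t ^ j * legendreD n m (cos t)) 0 PI = 0.
Proof.
  revert m; induction j as [|j IH]; intros m H.
  all: assert (0 < INR n - INR m) by (apply Rlt_0_minus, lt_INR; lia);
    pose proof (pos_INR n); pose proof (pos_INR m);
    assert (0 < (INR n - INR m) * (INR n + INR m + 1)) by nra.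
  all: apply Rmult_eq_reg_l with ((INR n - INR m) * (INR n + INR m + 1)); [|lra].
  all: rewrite RInt_legendreD_moment_S.
  - rewrite INR_0; ring.
  - cbn [pred]; rewrite IH by lia; ring.
Qed.

(** By parts, passing from [m] to [m + 1] multiplies the integral by [2 (m + 1)], up to an integral
    that is zero by orthogonality. *)
Lemma RInt_legendreD_endpoint (n m : nat) : (m < n)%nat ->
  RInt (fun t => sin t ^ (2 * m + 1) * (1 + cos t) * legendreD n (S m) (cos t)) 0 PI
  = 2 ^ S m * INR (fact m).
Proof.
  induction m as [|m IH]; intros H.
  - pose proof (RInt_legendreD_moment n 0 0 H) as O.
    (* Since [1 + x] vanishes at [x = -1], the boundary contributes only [2 P_n(1) = 2]. *)
    pose proof (RInt_lin2_exact
      (fun t => (1 + cos t) * legendreD n 0 (cos t)) (-1) (-1)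
      (fun t => sin t ^ (2 * 0 + 1) * cos t ^ 0 * legendreD n 0 (cos t))
      (fun t => sin t ^ (2 * 0 + 1) * (1 + cos t) * legendreD n 1 (cos t))
      0 PI) as E; cbv beta in E.
    rewrite O, cos_0, cos_PI, legendreD_0_1 in E.
    cut (-1 * RInt (fun t => sin t ^ (2 * 0 + 1) * (1 + cos t)
                        * legendreD n 1 (cos t)) 0 PI = -2).
    { rewrite INR_fact_0; intros; lra. }
    etransitivity; [|etransitivity; [apply E|ring]]; [ring|..].
    + continuity_by_derive.
    + continuity_by_derive.
    + intros t; auto_derive; [auto using ex_derive_legendreD|].
      rewrite Derive_legendreD; simpl; ring.
  - pose proof (RInt_legendreD_moment n (S m) 0) as O; rewrite Nat.add_0_r in O.
    specialize (IH ltac:(lia)).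
    (* The derivative of the weight brings in [x (1 + x) = (1 + x) - (1 - x^2)]; the coefficient
       [-(2 m + 3)] collects [-2 (m + 1)] from this split and [-1] from differentiating [1 + x]. *)
    pose proof (RInt_lin2 (2 * (INR m + 1)) (- (2 * INR m + 3))
      (fun t => sin t ^ (2 * m + 1) * (1 + cos t) * legendreD n (S m) (cos t))
      (fun t => sin t ^ (2 * S m + 1) * cos t ^ 0 * legendreD n (S m) (cos t)) 0 PI)
      as L; rewrite O, IH in L by lia.
    pose proof (RInt_lin2_exact
      (fun t => sin t ^ (2 * m + 2) * (1 + cos t) * legendreD n (S m) (cos t)) 1 (-1)
      (fun t => 2 * (INR m + 1) *
        (sin t ^ (2 * m + 1) * (1 + cos t) * legendreD n (S m) (cos t))
        + - (2 * INR m + 3) *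
        (sin t ^ (2 * S m + 1) * cos t ^ 0 * legendreD n (S m) (cos t)))
      (fun t => sin t ^ (2 * S m + 1) * (1 + cos t) * legendreD n (S (S m)) (cos t))
      0 PI) as E; cbv beta in E.
    rewrite sin_0, sin_PI, !pow_i, L in E by (lia || continuity_by_derive).
    rewrite INR_fact_S; change (2 ^ S (S m)) with (2 * 2 ^ S m).
    match type of E with _ -> _ -> _ -> _ + -1 * ?I = _ => set (V := I) in * end.
    apply Rminus_diag_uniq_sym.
    etransitivity; [|etransitivity; [apply E|ring]]; [ring|..].
    + continuity_by_derive.
    + continuity_by_derive.
    + clear E; clear L IH; intros t.
      replace (2 * S m + 1)%nat with (S (S (2 * m + 1))) by lia.
      replace (2 * m + 2)%nat with (S (2 * m + 1)) by lia.
      assert (He : INR (2 * m + 1) = 2 * INR m + 1)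
        by (rewrite plus_INR, mult_INR, INR_1; reflexivity).
      generalize dependent (2 * m + 1)%nat; intros e He.
      auto_derive; [auto using ex_derive_legendreD|].
      rewrite Derive_legendreD.
      simpl pred; rewrite S_INR, He; cbn [pow].
      generalize (sin t ^ e); intros S.
      pose proof (sin_mul_sin t) as Q.
      apply Rminus_diag_uniq.
      match goal with |- ?A = 0 => replace A with
        (2 * (INR m + 1) * S * legendreD n (Datatypes.S m) (cos t)
           * (sin t * sin t - (1 - cos t ^ 2))) by ring end.
      rewrite Q; ring.
Qed.

(* Replacing [x^j] by [x^(j+1)] changes the integrand by [1 - x] times it, and
   [(1 + x) (1 - x)] restores the weight of [RInt_legendreD_moment]. *)
Lemma RInt_legendreD_endpoint_pow (n m j : nat) : (S m + j <= n)%nat ->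
  RInt (fun t => sin t ^ (2 * m + 1) * (1 + cos t) * cos t ^ j
                 * legendreD n (S m) (cos t)) 0 PI
  = 2 ^ S m * INR (fact m).
Proof.
  induction j as [|j IH]; intros H.
  - rewrite <- (RInt_legendreD_endpoint n m) by lia.
    apply RInt_ext; intros; simpl; ring.
  - rewrite <- IH by lia.
    pose proof (RInt_legendreD_moment n (S m) j ltac:(lia)) as O.
    pose proof (RInt_lin2 1 (-1)
      (fun t => sin t ^ (2 * m + 1) * (1 + cos t) * cos t ^ j
                * legendreD n (S m) (cos t))
      (fun t => sin t ^ (2 * S m + 1) * cos t ^ j * legendreD n (S m) (cos t))
      0 PI) as L.
    rewrite O in L by continuity_by_derive.
    rewrite Rmult_0_r, Rplus_0_r, Rmult_1_l in L by continuity_by_derive.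
    rewrite <- L by continuity_by_derive.
    apply RInt_ext; intros t _.
    replace (2 * S m + 1)%nat with (S (S (2 * m + 1))) by lia; cbn [pow].
    pose proof (sin_mul_sin t) as Q.
    apply Rminus_diag_uniq.
    match goal with |- ?A = 0 => replace A with
      (sin t ^ (2 * m + 1) * cos t ^ j * legendreD n (S m) (cos t)
       * (sin t * sin t - (1 - cos t ^ 2))) by ring end.
    rewrite Q; ring.
Qed.

(** * The integral of [D_m(x y) D_m(x)] *)

Lemma is_RInt_sum (c : nat -> R) (f : nat -> R -> R) (u v : R) (N : nat) :
  (forall k t, continuous (f k) t) ->
  is_RInt (fun t => sum_f_R0 (fun k => c k * f k t) N) u v
    (sum_f_R0 (fun k => c k * RInt (f k) u v) N).
Proof.
  intros Hf; induction N as [|N IH]; cbn [sum_f_R0].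
  - apply (is_RInt_scal (V := R_NormedModule)),
      (RInt_correct (V := R_CompleteNormedModule)), ex_RInt_cont; auto.
  - apply (is_RInt_plus (V := R_NormedModule)); [exact IH|].
    apply (is_RInt_scal (V := R_NormedModule)),
      (RInt_correct (V := R_CompleteNormedModule)), ex_RInt_cont; auto.
Qed.

(** The reflection of [t] into [PI - t] shows that the integral equals its opposite. *)
Lemma RInt_antisym (f : R -> R) :
  (forall t, continuous f t) -> (forall t, f (PI - t) = - f t) ->
  RInt f 0 PI = 0.
Proof.
  intros Hf Ho.
  pose proof (RInt_comp_lin (V := R_CompleteNormedModule) f (-1) PI 0 PI) as L.
  replace (-1 * 0 + PI) with PI in L by ring.
  replace (-1 * PI + PI) with 0 in L by ring.
  specialize (L (ex_RInt_cont f _ _ Hf)).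
  rewrite (RInt_ext _ f) in L.
  - pose proof (opp_RInt_swap (V := R_CompleteNormedModule) f 0 PI
      (ex_RInt_cont f _ _ Hf)) as S.
    rewrite <- S in L; unfold opp in L; simpl in L.
    change (@eq R (RInt f 0 PI) (- RInt f 0 PI)) in L.
    change (@eq R (RInt f 0 PI) 0); lra.
  - intros t _; replace (-1 * t + PI) with (PI - t) by ring.
    rewrite Ho; unfold scal; simpl; unfold mult; simpl; ring.
Qed.

(** After the factor [1 + x] is inserted, every monomial of the expansion of [D_(m+1)(x y)] at [0]
    integrates to the same constant, so the expansion is summed back to [D_(m+1)(y)]. *)
Lemma RInt_legendreD_kernel (n m : nat) (y : R) : (m < n)%nat ->
  RInt (fun t => sin t ^ (2 * m + 1) * legendreD n (S m) (cos t * y)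
                 * legendreD n (S m) (cos t)) 0 PI
  = 2 ^ S m * INR (fact m) * legendreD n (S m) y.
Proof.
  intros H.
  (* Both derivatives carry the same parity sign, so the extra factor [cos t] makes the integrand
     odd under reflection. *)
  assert (Z : RInt (fun t => sin t ^ (2 * m + 1) * cos t
      * legendreD n (S m) (cos t * y) * legendreD n (S m) (cos t)) 0 PI = 0).
  { apply RInt_antisym; [continuity_by_derive|].
    intros t; rewrite sin_PI_x, Rtrigo_facts.cos_pi_minus.
    replace (- cos t * y) with (- (cos t * y)) by ring.
    rewrite !legendreD_opp by lia.
    assert (E : (-1) ^ (n - S m) * (-1) ^ (n - S m) = 1)
      by (rewrite <- Rpow_mult_distr; replace (-1 * -1) with 1 by ring; apply pow1).
    set (e := (-1) ^ (n - S m)) in *.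
    match goal with |- _ = ?r => transitivity (e * e * r); [ring|] end.
    rewrite E; ring. }
  pose proof (RInt_lin2 1 1
    (fun t => sin t ^ (2 * m + 1) * legendreD n (S m) (cos t * y)
              * legendreD n (S m) (cos t))
    (fun t => sin t ^ (2 * m + 1) * cos t
      * legendreD n (S m) (cos t * y) * legendreD n (S m) (cos t)) 0 PI) as L.
  rewrite Z in L by continuity_by_derive.
  rewrite Rmult_0_r, Rplus_0_r, Rmult_1_l in L by continuity_by_derive.
  rewrite <- L by continuity_by_derive.
  rewrite (legendreD_taylor n (S m) (n - S m) 0 y), scal_sum by lia.
  transitivity (sum_f_R0 (fun j => legendreD n (S m + j) 0 * ((y - 0) ^ j / INR (fact j))
     * RInt (fun t => sin t ^ (2 * m + 1) * (1 + cos t) * cos t ^ j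
                 * legendreD n (S m) (cos t)) 0 PI) (n - S m)).
  - assert (X : forall t, 1 * (sin t ^ (2 * m + 1) * legendreD n (S m) (cos t * y)
                 * legendreD n (S m) (cos t))
        + 1 * (sin t ^ (2 * m + 1) * cos t * legendreD n (S m) (cos t * y)
                 * legendreD n (S m) (cos t))
      = sum_f_R0 (fun j => legendreD n (S m + j) 0 * ((y - 0) ^ j / INR (fact j))
          * (sin t ^ (2 * m + 1) * (1 + cos t) * cos t ^ j
             * legendreD n (S m) (cos t))) (n - S m)).
    { intros t; rewrite (legendreD_taylor n (S m) (n - S m) 0 (cos t * y)) by lia.
      match goal with |- 1 * (?s * ?S * ?d) + 1 * _ = _ =>
        transitivity ((s * (1 + cos t) * d) * S); [ring|] end.
      rewrite scal_sum; apply sum_eq; intros j _.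
      rewrite !Rminus_0_r, Rpow_mult_distr; unfold Rdiv; ring. }
    apply is_RInt_unique.
    eapply is_RInt_ext; [intros t _; symmetry; apply X|].
    apply (is_RInt_sum _ (fun j t => sin t ^ (2 * m + 1) * (1 + cos t) * cos t ^ j
             * legendreD n (S m) (cos t))); continuity_by_derive.
  - apply sum_eq; intros j Hj; rewrite RInt_legendreD_endpoint_pow by lia; ring.
Qed.

(** * Green's identity for the coefficients *)

(* Here [m] is one less than the order of the Ferrers function, which keeps
   the exponent [m + k] free of truncated subtraction. *)
Definition addition_coef (n m k : nat) (y : R) : R :=
  RInt (fun t => sin t ^ (m + k) * legendreD n k (cos t * y)
                 * legendreD n (S m) (cos t)) 0 PI.

(** Put [f = sin^k t D_k(y cos t)] and [g = sin^(m+1) t D_(m+1)(cos t)]. Then [g] solves the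
    associated Legendre equation of order [m + 1], and [f] that of order [k] up to a term in
    [(1 - y^2) D_(k+2)(y cos t)]; Green's identity compares the two. *)
Lemma addition_coef_rec (n m k : nat) (y : R) :
  (1 - y ^ 2) * addition_coef n m (S (S k)) y
  = (INR k ^ 2 - INR (S m) ^ 2) * addition_coef n m k y.
Proof.
  unfold addition_coef.
  (* The primitive is [sin t (f' g - f g')], zero at both ends. *)
  pose proof (RInt_lin2_exact
    (fun t => sin t ^ S (m + k) *
       ((INR k - INR (S m)) * cos t * legendreD n k (cos t * y)
          * legendreD n (S m) (cos t)
        + sin t ^ 2 * (legendreD n k (cos t * y) * legendreD n (S (S m)) (cos t)
        - y * legendreD n (S k) (cos t * y) * legendreD n (S m) (cos t))))
    (INR k ^ 2 - INR (S m) ^ 2) (- (1 - y ^ 2))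
    (fun t => sin t ^ (m + k) * legendreD n k (cos t * y)
                 * legendreD n (S m) (cos t))
    (fun t => sin t ^ (m + S (S k)) * legendreD n (S (S k)) (cos t * y)
                 * legendreD n (S m) (cos t)) 0 PI) as E; cbv beta in E.
  rewrite sin_0, sin_PI, !(pow_i (S (m + k))) in E by lia.
  apply Rminus_diag_uniq_sym; etransitivity; [|etransitivity; [apply E|ring]]; [ring|..].
  - continuity_by_derive.
  - continuity_by_derive.
  - intros t; auto_derive; [repeat split; auto using ex_derive_legendreD|].
    rewrite !Derive_legendreD.
    replace (m + S (S k))%nat with (S (S (m + k))) by lia; simpl pred.
    rewrite !S_INR, plus_INR.
    cbn [pow]; generalize (sin t ^ (m + k)); intros S.
    pose proof (legendreD_ode n (Datatypes.S m) (cos t)) as O1.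
    pose proof (legendreD_ode n k (cos t * y)) as O2.
    pose proof (sin_mul_sin t) as Q.
    rewrite S_INR in O1.
    rewrite INR_0; apply Rminus_diag_uniq.
    (* What remains is a combination of the differential equations at [cos t] and at [y cos t]. *)
    match type of O1 with ?l1 = ?r1 => match type of O2 with ?l2 = ?r2 =>
      match goal with |- ?A = 0 => replace A with
        (S * (1 - cos t ^ 2) * (legendreD n (Datatypes.S m) (cos t) * (l2 - r2)
           - legendreD n k (cos t * y) * (l1 - r1))) by ring [Q] end end end.
    rewrite O1, O2; ring.
Qed.

(** * Chebyshev polynomials *)

(** The coefficient form of Chebyshev's equation [(1 - x^2) u'' - x u' + m^2 u = 0]. *)
Definition chebyshev_rec (m : nat) (u : nat -> R) : Prop :=
  forall k, (INR k + 2) * (INR k + 1) * u (S (S k)) = (INR k ^ 2 - INR m ^ 2) * u k.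

(** Going down from the bound [N], the factor [k^2 - m^2] is nonzero except at [k = m], where the
    value is given. *)
Lemma chebyshev_rec_unique (m N : nat) (u : nat -> R) :
  chebyshev_rec m u -> (forall k, (N < k)%nat -> u k = 0) -> u m = 0 ->
  forall k, u k = 0.
Proof.
  intros Hr Hz Hm.
  assert (H : forall d k, (N < k + d)%nat -> u k = 0).
  { induction d as [|d IH]; intros k Hk; [apply Hz; lia|].
    destruct (Nat.eq_dec k m) as [->|Hne]; [exact Hm|].
    pose proof (Hr k) as E; rewrite (IH (S (S k))), Rmult_0_r in E by lia.
    symmetry in E; apply Rmult_integral in E; destruct E as [E|E]; [exfalso|exact E].
    apply not_INR in Hne; pose proof (pos_INR k); pose proof (pos_INR m).
    assert (F : (INR k - INR m) * (INR k + INR m) = 0) by (rewrite <- E; ring).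
    apply Rmult_integral in F; destruct F; lra. }
  intros k; apply (H (S N)); lia.
Qed.

(** The coefficients of [T_(m+1)]. The last identity, [sin x T_M'(cos x) = M sin (M x)] for
    [M = m + 1], is carried along because the induction needs it. *)
Lemma chebyshev_coefficients (m : nat) : exists tau : nat -> R,
  chebyshev_rec (S m) tau /\ tau (S m) = 2 ^ m
  /\ (forall k, (S m < k)%nat -> tau k = 0)
  /\ (forall x, sum_f_R0 (fun k => tau k * cos x ^ k) (S m) = cos (INR (S m) * x))
  /\ (forall x, sin x * sum_f_R0 (fun k => (INR k + 1) * tau (S k) * cos x ^ k) m
                = INR (S m) * sin (INR (S m) * x)).
Proof.
  induction m as [|m (tau & Hr & Hl & Hz & Hc & Hs)].
  - exists (fun k => if Nat.eqb k 1 then 1 else 0); repeat split.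
    + intros [|[|k]]; cbn [Nat.eqb]; rewrite ?INR_0, ?INR_1; ring.
    + intros [|[|k]] H; [lia|lia|reflexivity].
    + intros x; simpl; rewrite INR_1, !Rmult_1_l; ring.
    + intros x; simpl; rewrite INR_1, INR_0, !Rmult_1_l; ring.
  - assert (HM : INR (S (S m)) = INR (S m) + 1) by apply S_INR.
    assert (Hm : INR (S m) = INR m + 1) by apply S_INR.
    pose proof (pos_INR m) as Pm.
    set (M := INR (S m)) in *.
    (* Higher coefficients come from [T_(M+1)' = (M + 1) (T_M + x T_M' / M)], the constant term from
       [T_(M+1) = x T_M - (1 - x^2) T_M' / M] at [x = 0]. *)
    exists (fun k => match k with
      | O => - tau 1%nat / M
      | S j => tau j * (M + INR j) * (M + 1) / (M * (INR j + 1)) end).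
    repeat split.
    + intros [|j]; rewrite HM.
      * rewrite INR_1, INR_0; field; lra.
      * pose proof (Hr j) as E; fold M in E; pose proof (pos_INR j).
        rewrite !S_INR.
        transitivity ((M + INR j + 2) * (M + 1) / (M * (INR j + 1))
           * ((INR j + 2) * (INR j + 1) * tau (S (S j)))); [field; lra|].
        rewrite E; field; lra.
    + rewrite Hl; fold M; rewrite Hm; cbn [pow]; field; lra.
    + intros [|k] H; [lia|]; rewrite Hz by lia; field; pose proof (pos_INR k); lra.
    + intros x.
      set (c := cos x).
      set (Sg := sum_f_R0 (fun k => (INR k + 1) * tau (S k) * c ^ k) m) in *.
      specialize (Hc x); specialize (Hs x); fold c Sg in Hc, Hs.
      assert (E1 : sum_f_R0 (fun j => INR j * tau j * c ^ j) (S m) = c * Sg).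
      { rewrite decomp_sum by lia; cbn [pred]; rewrite INR_0; unfold Sg.
        rewrite scal_sum, Rmult_0_l, Rmult_0_l, Rplus_0_l.
        apply sum_eq; intros i _; rewrite S_INR; cbn [pow]; ring. }
      assert (E2 : tau 1%nat
        + c * sum_f_R0 (fun j => (INR j + 2) * tau (S (S j)) * c ^ j) (S m) = Sg).
      { transitivity (sum_f_R0 (fun k => (INR k + 1) * tau (S k) * c ^ k) (S (S m))).
        - rewrite (decomp_sum _ (S (S m))) by lia; cbn [pred]; rewrite INR_0, scal_sum.
          f_equal; [simpl; ring|].
          apply sum_eq; intros i _; rewrite S_INR; cbn [pow]; ring.
        - cbn [sum_f_R0]; fold Sg; rewrite (Hz (S (S m))), (Hz (S (S (S m)))) by lia.
          ring. }
      rewrite decomp_sum by lia; cbn [pred].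
      (* The second of these formulas, coefficient by coefficient; with the identity for [T_M'] it
         becomes the addition formula for [cos]. *)
      transitivity (- tau 1%nat / M + c * (sum_f_R0 (fun k => tau k * c ^ k) (S m)
         + / M * sum_f_R0 (fun j => INR j * tau j * c ^ j) (S m)
         - / M * sum_f_R0 (fun j => (INR j + 2) * tau (S (S j)) * c ^ j) (S m))).
      * f_equal; [simpl; ring|].
        rewrite (scal_sum _ _ (/ M)), (scal_sum _ _ (/ M)), <- plus_sum, <- minus_sum,
          scal_sum.
        apply sum_eq; intros j _; cbn [pow]; pose proof (pos_INR j).
        replace (tau (S (S j)))
          with ((INR j ^ 2 - M ^ 2) * tau j / ((INR j + 2) * (INR j + 1))).
        -- field; lra.
        -- pose proof (Hr j) as E; fold M in E; rewrite <- E; field; lra.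
      * rewrite Hc, E1, HM, Rmult_plus_distr_r, Rmult_1_l, cos_plus; fold c.
        assert (E3 : sin (M * x) = sin x * Sg / M) by (rewrite Hs; field; lra).
        rewrite E3.
        transitivity (c * cos (M * x) + / M * (c * (c * Sg)) - / M * Sg).
        -- rewrite <- E2 at 3; field; lra.
        -- pose proof (sin_mul_sin x) as Q; fold c in Q.
           transitivity (cos (M * x) * c - (sin x * sin x) * Sg / M); [|field; lra].
           rewrite Q; field; lra.
    + intros x.
      set (c := cos x).
      set (Sg := sum_f_R0 (fun k => (INR k + 1) * tau (S k) * c ^ k) m) in *.
      specialize (Hc x); specialize (Hs x); fold c Sg in Hc, Hs.
      assert (E1 : sum_f_R0 (fun j => INR j * tau j * c ^ j) (S m) = c * Sg).
      { rewrite decomp_sum by lia; cbn [pred]; rewrite INR_0; unfold Sg.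
        rewrite scal_sum, Rmult_0_l, Rmult_0_l, Rplus_0_l.
        apply sum_eq; intros i _; rewrite S_INR; cbn [pow]; ring. }
      (* The first formula, which becomes the addition formula for [sin]. *)
      transitivity (sin x * ((M + 1) * (sum_f_R0 (fun k => tau k * c ^ k) (S m)
         + / M * sum_f_R0 (fun j => INR j * tau j * c ^ j) (S m)))).
      * f_equal.
        rewrite (scal_sum _ _ (/ M)), <- plus_sum, scal_sum.
        apply sum_eq; intros j _; pose proof (pos_INR j); field; lra.
      * rewrite Hc, E1, HM, (Rmult_plus_distr_r M 1 x), Rmult_1_l, sin_plus; fold c.
        assert (E3 : sin (M * x) = sin x * Sg / M) by (rewrite Hs; field; lra).
        rewrite E3; field; lra.
Qed.

(** By uniqueness [b] is a multiple of the coefficients of [T_(m+1)], and the ratio is read off at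
    the leading coefficient [2^m]. *)
Lemma chebyshev_rec_sum (m N : nat) (b : nat -> R) (x : R) :
  (S m <= N)%nat -> chebyshev_rec (S m) b -> (forall k, (N < k)%nat -> b k = 0) ->
  sum_f_R0 (fun k => b k * cos x ^ k) N = b (S m) / 2 ^ m * cos (INR (S m) * x).
Proof.
  intros HN Hb Hz.
  destruct (chebyshev_coefficients m) as (tau & Hr & Hl & Ht & Hc & _).
  pose proof (pow_nonzero 2 m ltac:(lra)) as H2.
  assert (E : forall k, b k - b (S m) / 2 ^ m * tau k = 0).
  { apply (chebyshev_rec_unique (S m) N).
    - intros k; rewrite Rmult_minus_distr_l, (Hb k).
      transitivity ((INR k ^ 2 - INR (S m) ^ 2) * b k - b (S m) / 2 ^ m
        * ((INR k + 2) * (INR k + 1) * tau (S (S k)))); [ring|].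
      rewrite (Hr k); ring.
    - intros k Hk; rewrite Hz, Ht by lia; ring.
    - rewrite Hl; field; exact H2. }
  rewrite <- Hc.
  replace (sum_f_R0 (fun k => tau k * cos x ^ k) (S m))
    with (sum_f_R0 (fun k => tau k * cos x ^ k) N).
  - rewrite scal_sum; apply sum_eq; intros k _.
    rewrite (Rminus_diag_uniq _ _ (E k)); ring.
  - clear - HN Ht; induction HN as [|N HN IH]; [reflexivity|].
    cbn [sum_f_R0]; rewrite (Ht (S N)), IH by lia; cbn [sum_f_R0]; ring.
Qed.

(** * The integral in polynomial form *)

(** The theorem for order [m + 1] without its sign: the division by the sine has lowered [sin^(m+1)]
    to [sin^m], which leaves a smooth integrand. *)
Lemma RInt_legendreP_addition (m n : nat) (a psi : R) : (m < n)%nat ->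
  RInt (fun t => sin t ^ m * legendreD n (S m) (cos t)
          * legendreP n (cos t * cos a + sin t * sin a * cos psi)) 0 PI
  = 2 / INR (S m) * sin a ^ S m * legendreD n (S m) (cos a)
    * cos (INR (S m) * psi).
Proof.
  intros Hm.
  set (b := fun k => sin a ^ k / INR (fact k) * addition_coef n m k (cos a)).
  assert (X : forall t, sin t ^ m * legendreD n (S m) (cos t)
          * legendreP n (cos t * cos a + sin t * sin a * cos psi)
    = sum_f_R0 (fun k => sin a ^ k / INR (fact k) * cos psi ^ k
        * (sin t ^ (m + k) * legendreD n k (cos t * cos a)
           * legendreD n (S m) (cos t))) n).
  { intros t; rewrite <- legendreD_0, (legendreD_taylor n 0 n (cos t * cos a)),
      scal_sum by lia.
    apply sum_eq; intros k _; cbn [Nat.add].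
    replace (cos t * cos a + sin t * sin a * cos psi - cos t * cos a)
      with (sin t * sin a * cos psi) by ring.
    rewrite !Rpow_mult_distr, pow_add; unfold Rdiv; ring. }
  transitivity (sum_f_R0 (fun k => b k * cos psi ^ k) n).
  - apply is_RInt_unique; eapply is_RInt_ext; [intros t _; symmetry; apply X|].
    replace (sum_f_R0 (fun k => b k * cos psi ^ k) n) with
      (sum_f_R0 (fun k => sin a ^ k / INR (fact k) * cos psi ^ k
                          * addition_coef n m k (cos a)) n)
      by (apply sum_eq; intros k _; unfold b; ring).
    apply (is_RInt_sum _ (fun k t => sin t ^ (m + k) * legendreD n k (cos t * cos a)
           * legendreD n (S m) (cos t))).
    continuity_by_derive.
  - rewrite (chebyshev_rec_sum m n b psi).
    (* The constants combine to [2^(m+1) m! / ((m+1)! 2^m) = 2 / (m+1)]. *)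
    + unfold b, addition_coef; replace (m + S m)%nat with (2 * m + 1)%nat by lia.
      rewrite RInt_legendreD_kernel by lia.
      rewrite INR_fact_S, S_INR.
      pose proof (INR_fact_neq_0 m); pose proof (pos_INR m).
      pose proof (pow_nonzero 2 m ltac:(lra)).
      match goal with |- @eq _ ?l ?r => change (@eq R l r) end.
      cbn [pow]; field; repeat split; lra.
    + lia.
    (* Two of the factors [sin a] in [b (k + 2)] supply [1 - y^2], so no division by [sin a]
       occurs. *)
    + intros k; unfold b.
      pose proof (addition_coef_rec n m k (cos a)) as E; rewrite <- sin_mul_sin in E.
      rewrite !INR_fact_S, S_INR; cbn [pow].
      pose proof (INR_fact_neq_0 k); pose proof (pos_INR k).
      transitivity (sin a ^ k / INR (fact k)
        * (sin a * sin a * addition_coef n m (S (S k)) (cos a))); [field; repeat split; lra|].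
      rewrite E; cbn [pow]; ring.
    + intros k Hk; unfold b, addition_coef.
      rewrite (RInt_ext _ (fun _ => 0)).
      * rewrite (RInt_const (V := R_CompleteNormedModule)).
        unfold scal; simpl; unfold mult; simpl; ring.
      * intros t _; rewrite legendreD_gt by lia; rewrite Rmult_0_r, Rmult_0_l.
        reflexivity.
Qed.

(** * Return to the Ferrers functions *)

Lemma ferrersP_cos (m n : nat) (t : R) : 0 <= sin t ->
  ferrersP m n (cos t) = (-1) ^ m * sin t ^ m * legendreD n m (cos t).
Proof.
  intros H; unfold ferrersP.
  rewrite Derive_n_legendreP, <- sin_mul_sin, sqrt_square by exact H; reflexivity.
Qed.

Theorem theorem3p6 (m n : nat) (theta' phi phi' : R) :
  (1 <= m)%nat -> (m <= n)%nat ->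
  0 <= theta' <= PI ->
  0 <= phi < 2 * PI -> 0 <= phi' < 2 * PI ->
  RInt (fun theta =>
          legendreP n (cos theta * cos theta' + sin theta * sin theta' * cos (phi - phi'))
          * ferrersP m n (cos theta) * / sin theta) 0 PI
  = 2 / INR m * ferrersP m n (cos theta') * cos (INR m * (phi - phi')).
Proof.
  intros H1 Hmn [Ha Hb] _ _; destruct m as [|m]; [lia|].
  (* The integrands need to agree only on the open interval, where [sin t > 0] and [/ sin t] is a
     genuine inverse. *)
  rewrite (RInt_ext _ (fun t => (-1) ^ S m * (sin t ^ m * legendreD n (S m) (cos t)
    * legendreP n (cos t * cos theta' + sin t * sin theta' * cos (phi - phi'))))).
  - rewrite (RInt_scal (V := R_CompleteNormedModule)).
    + rewrite RInt_legendreP_addition, ferrersP_cos by (lia || now apply sin_ge_0).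
      unfold scal; simpl; unfold mult; simpl; ring.
    + apply ex_RInt_cont; intros t.
      apply (continuous_ext (fun t => sin t ^ m * legendreD n (S m) (cos t)
        * legendreD n 0
            (cos t * cos theta' + sin t * sin theta' * cos (phi - phi')))).
      * intros s; rewrite legendreD_0; reflexivity.
      * continuity_by_derive.
  - rewrite Rmin_left, Rmax_right by (pose proof PI_RGT_0; lra).
    intros t [Ht0 Ht1]; pose proof (sin_gt_0 t Ht0 Ht1) as Hs.
    rewrite ferrersP_cos by lra.
    match goal with |- @eq _ ?l ?r => change (@eq R l r) end.
    cbn [pow]; field; lra.
Qed.
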